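(* Let $H$ be a fixed connected planar graph with $e(H)>|H|$, and let $m=m(n)$ be such that $d=d(n)=n-m$ satisfies $d>0$ and $d=\omega\big(n^{|H|/e(H)}\big)$. Then $\mathbf{P}[P_{n,m}\text{ has a subgraph isomorphic to } H]\to0$ as $n\to\infty$.
   Context: $\mathcal{P}(n,m)$ is the set of simple labelled planar graphs on vertex set $\{1,\ldots,n\}$ with exactly $m$ edges; $P_{n,m}$ is chosen uniformly at random from $\mathcal{P}(n,m)$. $e(H)$ is the number of edges and $|H|$ the number of vertices of $H$. *)

(* Defs.v *)
From HB Require Import structures.
From mathcomp Require Import all_boot all_order all_algebra.
From mathcomp Require Import all_classical all_reals all_analysis.

Set Implicit Arguments.
Unset Strict Implicit.
Unset Printing Implicit Defensive.
Import Order.TTheory GRing.Theory Num.Theory.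
Import numFieldNormedType.Exports.
Local Open Scope classical_set_scope.
Local Open Scope ring_scope.

(* A simple graph on V is its set of edges, each edge being the set of its two
   (distinct) endpoints. *)
Record sgraph (V : finType) := SGraph {
  edges : {set {set V}};
  edges_simple : [forall e in edges, #|e| == 2%N] }.

HB.instance Definition _ (V : finType) := [isSub for @edges V].
HB.instance Definition _ (V : finType) := [Equality of sgraph V by <:].
HB.instance Definition _ (V : finType) := [Choice of sgraph V by <:].
HB.instance Definition _ (V : finType) := [Countable of sgraph V by <:].
HB.instance Definition _ (V : finType) := [Finite of sgraph V by <:].

Section Graphs.
Variable V : finType.
Implicit Type G : sgraph V.

Definition adj G : rel V := fun x y => [set x; y]%SET \in edges G.

Definition connected_graph G : Prop :=
  (0 < #|V|)%N /\ forall x y : V, connect (adj G) x y.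

(* G has a (not necessarily induced) subgraph isomorphic to H. *)
Definition has_subgraph (T : finType) (H : sgraph T) G : Prop :=
  exists2 f : T -> V, injective f &
    forall e : {set T}, e \in edges H -> (f @: e)%SET \in edges G.

End Graphs.

Section Planarity.
Variable R : realType.

(* A simple arc, given by a parametrization on [0, 1]; the values of g outside
   [0, 1] are irrelevant. *)
Definition simple_arc (g : R -> R * R) : Prop :=
  {within `[0, 1], continuous g} /\ {in `[0, 1] &, injective g}.

(* pos places the vertices in the plane R * R and arc draws the edges; two
   drawn edges meet at most in common endpoints. *)
Record plane_drawing (V : finType) (G : sgraph V)
    (pos : V -> R * R) (arc : {set V} -> R -> R * R) : Prop := {
  drawing_pos_inj : injective pos;
  drawing_arc : forall e, e \in edges G -> simple_arc (arc e);
  drawing_ends : forall e, e \in edges G ->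
    exists x y : V, [/\ e = [set x; y]%SET, arc e 0 = pos x & arc e 1 = pos y];
  drawing_arc_vertex : forall e (v : V) (t : R), e \in edges G ->
    t \in `]0, 1[ -> arc e t <> pos v;
  drawing_arc_arc : forall e e' (s t : R), e \in edges G -> e' \in edges G ->
    e <> e' -> s \in `]0, 1[ -> t \in `]0, 1[ -> arc e s <> arc e' t }.

Definition planar (V : finType) (G : sgraph V) : Prop :=
  exists pos arc, plane_drawing G pos arc.

(* The labels 1, ..., n are represented by the elements 0, ..., n - 1 of 'I_n. *)
Definition planar_graphs (n m : nat) : {set sgraph 'I_n} :=
  [set G : sgraph 'I_n | `[< planar G >] && (#|edges G| == m)]%SET.

(* The probability that a uniform random element of planar_graphs n m has the
   property A (with the junk value 0 if there is no such graph). *)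
Definition prob_planar (n m : nat) (A : sgraph 'I_n -> Prop) : R :=
  #|[set G in planar_graphs n m | `[< A G >]]%SET|%:R / #|planar_graphs n m|%:R.

End Planarity.

(* Main.v *)
(* Let k = e(H), h = |H| and d = n - m. A graph of P(n,m) containing H is recovered
   from the graph of P(n,m-k) obtained by deleting the edges of a copy of H together
   with the placement of that copy, so there are at most n^h |P(n,m-k)| of them.
   Conversely, a component of a graph with j < m edges has at most j+1 vertices, so
   at least n(n-j-1) >= nd ordered pairs of vertices lie in different components, and
   joining such a pair keeps the graph planar; since the result has at most 2m <= 2n
   oriented edges, d |P(n,j)| <= 2 |P(n,j+1)|. Hence the probability is at most
   (2/d)^k n^h = (2 n^(h/k) / d)^k.
   That a bridge preserves planarity of topological drawings is seen by redrawing: a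
   small ball around x is made to contain only straight spokes, and an inversion about
   a point between two spokes yields a bounded drawing in which a ray issuing from x is
   free. *)
Require Import Defs.
From mathcomp Require Import all_boot all_order all_algebra.
From mathcomp Require Import all_classical all_reals all_analysis.
From mathcomp Require Import ring lra zify.
Import Order.TTheory GRing.Theory Num.Theory.
Import numFieldNormedType.Exports.
Local Open Scope classical_set_scope.
Local Open Scope ring_scope.

Set Implicit Arguments.
Unset Strict Implicit.
Unset Printing Implicit Defensive.

(** * Plane drawings *)

Lemma point_avoid_near (R : realType) (p z : R * R) :
  p <> z -> \forall w \near z, p <> w.
Proof.
move=> pz; have /closed_openC oC : closed [set p].
  by apply: compact_closed; [exact: norm_hausdorff|exact: compact_set1].
have : nbhs z (~` [set p]) by apply/open_nbhs_nbhs/(conj oC)/nesym.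
by apply: filterS => w /nesym.
Qed.

Section Drawing.
Variables (R : realType) (V : finType) (G : sgraph V).
Implicit Types (pos : V -> R * R) (arc : {set V} -> R -> R * R).

(** Isolated vertices lie on no arc, hence the separate disjunct for vertices. *)
Definition drawn pos arc : set (R * R) := [set z | (exists v, pos v = z) \/
  exists e t, [/\ e \in edges G, t \in `[0, 1] & arc e t = z]].

Lemma edge_card2 (e : {set V}) : e \in edges G -> #|e| = 2%N.
Proof. by move=> eG; apply/eqP; move/forall_inP: (edges_simple G); exact. Qed.

Lemma drawn_vertex pos arc v : drawn pos arc (pos v).
Proof. by left; exists v. Qed.

Lemma drawn_arc pos arc e t : e \in edges G -> t \in `[0, 1] ->
  drawn pos arc (arc e t).
Proof. by move=> eG t01; right; exists e, t. Qed.

Lemma itvoo01_cc (t : R) : t \in `]0, 1[ -> t \in `[0, 1].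
Proof. by rewrite !in_itv /= => /andP[t0 t1]; rewrite !ltW. Qed.

(** Injectivity and continuity are asked on the drawn set only, so that maps with a singularity off
    the drawing, such as an inversion, qualify. *)
Lemma drawing_map pos arc (phi : R * R -> R * R) :
  plane_drawing G pos arc ->
  (forall z w, drawn pos arc z -> drawn pos arc w -> phi z = phi w -> z = w) ->
  (forall z, drawn pos arc z -> {for z, continuous phi}) ->
  plane_drawing G (phi \o pos) (fun e => phi \o arc e).
Proof.
move=> [pinj parc pends pav paa] phi_inj phi_cont; split.
- by move=> v w pvw; apply/pinj/phi_inj => //; exact: drawn_vertex.
- move=> e eG; have [ce ie] := parc e eG; split.
    apply/subspace_continuousP => t t01.
    apply: cvg_comp; last exact/phi_cont/drawn_arc.
    by move/subspace_continuousP: ce; exact.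
  by move=> s t s01 t01 st; apply/ie/phi_inj => //; exact: drawn_arc.
- by move=> e eG; have [a [b [-> e0 e1]]] := pends e eG; exists a, b;
    split => //=; rewrite ?e0 ?e1.
- move=> e v t eG t01 /= et; apply: (pav e v t eG t01).
  by apply: phi_inj et; [apply: drawn_arc => //; exact: itvoo01_cc|exact: drawn_vertex].
- move=> e e' s t eG e'G ee' s01 t01 /= et.
  apply: (paa e e' s t eG e'G ee' s01 t01).
  by apply: phi_inj et; apply: drawn_arc => //; exact: itvoo01_cc.
Qed.

Lemma drawn_map pos arc (phi : R * R -> R * R) z :
  drawn (phi \o pos) (fun e => phi \o arc e) z ->
  exists2 w, drawn pos arc w & phi w = z.
Proof.
case=> [[v <-]|[e [t [eG t01 <-]]]]; first by exists (pos v) => //; left; exists v.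
by exists (arc e t) => //; exact: drawn_arc.
Qed.

Lemma arc_avoid_near (g : R -> R * R) z : {within `[0, 1], continuous g} ->
  (forall t, t \in `[0, 1] -> g t <> z) ->
  \forall w \near z, forall t, t \in `[0, 1] -> g t <> w.
Proof.
move=> cg gz; have := continuous_compact cg (@segment_compact R 0 1).
move=> /(compact_closed (@norm_hausdorff _ _)) /closed_openC oC.
have : nbhs z (~` [set g x | x in `[0, 1]]).
  apply/open_nbhs_nbhs/(conj oC) => -[t t01]; exact: gz.
by apply: filterS => w Cw t t01 gtw; apply: Cw; exists t.
Qed.

(** The drawing is a finite union of points and compact arcs, hence closed. *)
Lemma drawn_avoid_near pos arc z : plane_drawing G pos arc ->
  ~ drawn pos arc z -> \forall w \near z, ~ drawn pos arc w.
Proof.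
move=> [_ parc _ _ _] zD.
have Hv : \forall w \near z, forall v, pos v <> w.
  apply: (@filter_forall _ _ (fun v w => pos v <> w) (nbhs z) _) => v.
  by apply: point_avoid_near => pvz; apply: zD; left; exists v.
have He : \forall w \near z, forall e : {set V}, e \in edges G ->
    forall t, t \in `[0, 1] -> arc e t <> w.
  apply: (@filter_forall _ _ (fun e w => e \in edges G ->
    forall t, t \in `[0, 1] -> arc e t <> w) (nbhs z) _) => e.
  have [eG|eG] := boolP (e \in edges G); last by apply: filterE.
  have [ce _] := parc e eG.
  have : forall t, t \in `[0, 1] -> arc e t <> z.
    by move=> t t01 et; apply: zD; right; exists e, t.
  by move=> /(arc_avoid_near ce); apply: filterS => w h _.
near=> w => -[[v]|[e [t [eG t01]]]].
  by apply: (near Hv w).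
by apply: (near He w).
Unshelve. all: by end_near. Qed.

(** Since [sigma e] maps the whole line into [0, 1], the new arcs are continuous everywhere and not
    merely within [0, 1]. The condition on the ends allows an arc to be reversed. *)
Lemma drawing_reparam pos arc (sigma : {set V} -> R -> R) :
  plane_drawing G pos arc ->
  (forall e, continuous (sigma e)) ->
  (forall e t, sigma e t \in `[0, 1]) ->
  (forall e, {in `[0, 1] &, injective (sigma e)}) ->
  (forall e t, t \in `]0, 1[ -> sigma e t \in `]0, 1[) ->
  (forall e, (sigma e 0 = 0 /\ sigma e 1 = 1) \/
             (sigma e 0 = 1 /\ sigma e 1 = 0)) ->
  plane_drawing G pos (fun e => arc e \o sigma e) /\
  forall e, e \in edges G -> continuous (arc e \o sigma e).
Proof.
move=> [pinj parc pends pav paa] sc s01 sinj soo send.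
have cont e : e \in edges G -> continuous (arc e \o sigma e).
  move=> eG t; have [/subspace_continuousP ce _] := parc e eG.
  apply: (@cvg_comp _ _ _ _ _ _ (within [set t0 | t0 \in `[0, 1]] (nbhs (sigma e t))));
    last exact: (ce _ (s01 e t)).
  move=> A wA.
  have : \forall u \near t, sigma e u \in `[0, 1] -> A (sigma e u) := sc e t _ wA.
  by apply: filterS => u; apply; exact: s01.
split=> //; split => //.
- move=> e eG; split; first exact/continuous_subspaceT/cont.
  have [_ ie] := parc e eG.
  by move=> a b a01 b01 /= /ie ab; apply: sinj a01 b01 _; apply: ab; exact: s01.
- move=> e eG; have [a [b [-> e0 e1]]] := pends e eG.
  have [[h0 h1]|[h0 h1]] := send [set a; b]%SET.
    by exists a, b; split => //=; rewrite ?h0 ?h1.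
  by exists b, a; split => //=; rewrite ?h0 ?h1 // finset.setUC.
- by move=> e v t eG t01 /=; apply: pav => //; exact: soo.
- by move=> e e' s t eG e'G ee' hs ht /=; apply: paa => //; exact: soo.
Qed.

End Drawing.

(** * Straightening a drawing near a vertex *)

Lemma last_exit (R : realType) (f : R -> R) (r : R) : continuous f ->
  f 0 < r < f 1 ->
  exists2 s, s \in `]0, 1[ & f s = r /\ forall t, s < t <= 1 -> r < f t.
Proof.
move=> cf /andP[f0r rf1].
(* The exit time is the largest time in [0, 1] with value at most [r]. A value below [r] there
   would, by the intermediate value theorem, yield a later time with value [r]. *)
have cA : compact (`[0, 1]%classic `&` (f @^-1` [set y | y <= r])).
  apply: compact_closedI; first exact: segment_compact.
  by apply: closed_comp => [x _|]; [exact: cf|exact: closed_le].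
have A0 : (`[0, 1]%classic `&` (f @^-1` [set y | y <= r])) !=set0.
  by exists 0; split => /=; rewrite ?in_itv/= ?lexx ?ler01// ltW.
have [s /set_mem[/= s01 fsr] smax] :=
    compact_EVT_max A0 cA (@continuous_subspaceT _ _ _ idfun (fun=> cvg_id)).
have after t : s < t <= 1 -> r < f t.
  move=> /andP[st t1]; rewrite ltNge; apply/negP => ftr.
  suff : t <= s by rewrite leNgt st.
  apply: smax; apply/mem_set; split => //=; rewrite in_itv/= t1 andbT.
  by move: s01; rewrite in_itv/= => /andP[s0 _]; rewrite (le_trans s0) ?ltW.
have [s0 s1] : 0 <= s /\ s <= 1 by move: s01; rewrite in_itv /= => /andP[].
have fs : f s = r.
  apply/eqP; rewrite eq_le fsr/= leNgt; apply/negP => fslt.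
  have [] := @IVT R f s 1 r s1 (continuous_subspaceT cf).
    by rewrite ge_min fsr le_max (ltW rf1) orbT.
  move=> t; rewrite in_itv/= => /andP[st t1] ftr.
  have ts : s < t.
    by rewrite lt_neqAle st andbT; apply/eqP => ts; rewrite ts ftr ltxx in fslt.
  by have := after t; rewrite ts t1 ftr ltxx => /(_ isT).
exists s => //; rewrite in_itv/= !lt_neqAle s0 s1 !andbT; apply/andP; split.
  by apply/eqP => s00; rewrite s00 fs ltxx in f0r.
by apply/eqP => s00; rewrite -s00 fs ltxx in rf1.
Qed.

Section Spokes.
Variables (R : realType) (V : finType) (G : sgraph V) (x : V).

(** Arcs that end at [x] are reversed, parameters are clamped to [0, 1] to get continuity on the
    whole line, and a translation moves [x] to the origin. *)
Lemma rooted_drawing : planar R G ->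
  exists pos arc, [/\ @plane_drawing R V G pos arc,
    forall e, e \in edges G -> continuous (arc e), pos x = 0 &
    forall e, e \in edges G -> x \in e -> arc e 0 = 0].
Proof.
move=> [pos [arc D]].
pose rev (e : {set V}) := (x \in e) && (arc e 0 != pos x).
pose clamp (t : R) := Num.min (Num.max 0 t) 1.
pose sigma (e : {set V}) (t : R) := if rev e then 1 - clamp t else clamp t.
have cc : continuous clamp.
  move=> t; apply: continuous_min; last exact: cvg_cst.
  by apply: continuous_max; [exact: cvg_cst|exact: cvg_id].
have c0 t : 0 <= clamp t <= 1.
  by rewrite /clamp /Num.min /Num.max; do !case: ifPn; rewrite -?leNgt; lra.
have cE t : 0 <= t <= 1 -> clamp t = t.
  move=> /andP[t0 t1]; rewrite /clamp; have -> : Num.max 0 t = t by apply/max_idPr.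
  exact/min_idPl.
have [] := @drawing_reparam R V G pos arc sigma D.
- move=> e; rewrite /sigma; case: (rev e) => // t.
  by apply: cvgB; [exact: cvg_cst|exact: cc].
- by move=> e t; rewrite in_itv/= /sigma; have := c0 t; case: (rev e) => //; lra.
- move=> e s t; rewrite !in_itv/= => s01 t01; rewrite /sigma !cE//.
  by case: (rev e) => //; lra.
- move=> e t; rewrite !in_itv/= => t01; rewrite /sigma cE; last by lra.
  by case: (rev e) => //; lra.
- move=> e; rewrite /sigma !cE ?lexx ?ler01//.
  by case: (rev e); [right|left]; rewrite ?subr0 ?subrr.
move=> D' cD'; pose phi (z : R * R) := z - pos x.
have cphi z : {for z, continuous phi}.
  by apply: cvgB; [exact: cvg_id|exact: cvg_cst].
exists (phi \o pos), (fun e => phi \o (arc e \o sigma e)); split.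
- by apply: drawing_map => // z w _ _ /addIr.
- by move=> e eG t; apply: continuous_comp; [exact: cD'|exact: cphi].
- by rewrite /phi/= subrr.
- move=> e eG xe; apply/eqP; rewrite /= /phi subr_eq0 /sigma cE ?lexx ?ler01//.
  rewrite /rev xe/=; case: ifPn => [ne|]; last by rewrite negbK.
  rewrite subr0; have [a [b [eE e0 e1]]] := drawing_ends D eG.
  move: xe ne; rewrite {1}eE !inE => /orP[]/eqP ->; first by rewrite e0 eqxx.
  by rewrite e1.
Qed.

End Spokes.

(* Every arc at [x] is kept from its last exit of a small ball around [x] on, and its
   beginning is replaced by the radius to the exit point. *)
Lemma spoked_drawing (R : realType) (V : finType) (G : sgraph V) (x : V) :
  planar R G ->
  exists pos arc (r : R) (p : {set V} -> R * R),
    [/\ plane_drawing G pos arc, pos x = 0, 0 < r &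
      forall z, drawn G pos arc z -> `|z| <= r -> exists e (u : R),
        0 <= u /\ z = u *: p e].
Proof.
move=> /(rooted_drawing x)[pos [arc [D cD x0 a0]]].
have [pinj parc pends pav paa] := D.
have end1 e : e \in edges G -> x \in e -> exists2 v, v != x & arc e 1 = pos v.
  move=> eG xe; have [a [b [eE e0 e1]]] := pends e eG; exists b => //.
  have /pinj ax : pos a = pos x by rewrite -e0 x0 a0.
  apply/eqP => bx; have := edge_card2 eG.
  by rewrite eE ax bx finset.setUid cards1.
have Hv : \forall w \near (0 : R * R), forall v, v != x -> pos v <> w.
  apply: (@filter_forall _ _ (fun v w => v != x -> pos v <> w) (nbhs _) _) => v.
  have [->|vx] := eqVneq v x; first exact: filterE.
  have : pos v <> 0 by rewrite -x0 => /pinj /eqP; exact/negP.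
  by move=> /point_avoid_near; apply: filterS => w h _.
have He : \forall w \near (0 : R * R), forall e : {set V}, e \in edges G ->
    x \notin e -> forall t, t \in `[0, 1] -> arc e t <> w.
  apply: (@filter_forall _ _ (fun e w => e \in edges G -> x \notin e ->
    forall t, t \in `[0, 1] -> arc e t <> w) (nbhs _) _) => e.
  have [eG|eG] := boolP (e \in edges G); last by apply: filterE.
  have [xe|xe] := boolP (x \in e); first by apply: filterE.
  have [ce _] := parc e eG; have [a [b [eE e0 e1]]] := pends e eG.
  have : forall t, t \in `[0, 1] -> arc e t <> 0.
    move=> t t01 et0.
    have [t0|t0] := eqVneq t 0.
      have /pinj ax : pos a = pos x by rewrite -e0 x0 -t0.
      by rewrite eE ax !inE eqxx in xe.
    have [t1|t1] := eqVneq t 1.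
      have /pinj bx : pos b = pos x by rewrite -e1 x0 -t1.
      by rewrite eE bx !inE eqxx orbT in xe.
    apply: (pav e x t eG); last by rewrite x0.
    move: t01; rewrite !in_itv/= => /andP[t00 t11].
    by rewrite !lt_neqAle t00 t11 eq_sym t0 t1.
  by move=> /(arc_avoid_near ce); apply: filterS => w h _.
(* The open ball of radius [rho] holds no vertex but [x] and meets no arc of an edge missing [x].
   Halving [rho] gives a closed ball with the same property. *)
have [rho /= rho0 Hrho] : exists2 rho : R, 0 < rho & forall w : R * R, `|w| < rho ->
    (forall v, v != x -> pos v <> w) /\
    (forall e : {set V}, e \in edges G -> x \notin e ->
      forall t, t \in `[0, 1] -> arc e t <> w).
  have [rho /= rho0 H] := proj1 (nbhs_normP _ _) (filterI Hv He); exists rho => // w wr.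
  by apply: H; rewrite /= sub0r normrN.
pose r := rho / 2; have r0 : 0 < r by rewrite divr_gt0.
have rrho : r < rho by rewrite /r; lra.
have pos_far v : v != x -> r < `|pos v|.
  move=> vx; rewrite ltNge; apply/negP => /le_lt_trans/(_ rrho)/Hrho[+ _].
  by move=> /(_ v vx); apply.
have arc_far e t : e \in edges G -> x \notin e -> t \in `[0, 1] -> r < `|arc e t|.
  move=> eG xe t01; rewrite ltNge; apply/negP => /le_lt_trans/(_ rrho)/Hrho[_].
  by move=> /(_ e eG xe t t01); apply.
pose inc e := (e \in edges G) && (x \in e).
have /choice[s Hs] e : exists s : R, inc e -> [/\ s \in `]0, 1[, `|arc e s| = r &
    forall t, s < t <= 1 -> r < `|arc e t|].
  have [/andP[eG xe]|ie] := boolP (inc e); last by exists 0.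
  have cn : continuous (fun t => `|arc e t|).
    by move=> t; apply: cvg_norm; exact: cD.
  have [|s s01 [h1 h2]] := last_exit (r := r) cn; last by exists s.
  rewrite a0// normr0 r0/=; have [v vx ->] := end1 e eG xe; exact: pos_far.
pose p (e : {set V}) : R * R := if inc e then arc e (s e) else 0.
have pE e : inc e -> p e = arc e (s e) by rewrite /p => ->.
have pr e : inc e -> `|p e| = r by move=> ie; rewrite pE//; case: (Hs e ie).
have s0 e : inc e -> 0 < s e < 1 by move=> /Hs[+ _ _]; rewrite in_itv.
(* Radius up to time [s e], original arc afterwards, in one continuous formula. *)
pose arc' (e : {set V}) t := if inc e then
    arc e (Num.max t (s e)) - p e + (Num.min t (s e) / s e) *: p e else arc e t.
have arcN e : ~~ inc e -> arc' e = arc e.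
  by move=> ie; apply/funext => t; rewrite /arc' (negbTE ie).
have arcL e t : inc e -> t <= s e -> arc' e t = (t / s e) *: p e.
  move=> ie ts; rewrite /arc' ie.
  have -> : Num.max t (s e) = s e by apply/max_idPr.
  have -> : Num.min t (s e) = t by apply/min_idPl.
  by rewrite pE// subrr add0r.
have arcR e t : inc e -> s e <= t -> arc' e t = arc e t.
  move=> ie ts; rewrite /arc' ie.
  have -> : Num.max t (s e) = t by apply/max_idPl.
  have -> : Num.min t (s e) = s e by apply/min_idPr.
  by rewrite divff ?scale1r ?subrK// gt_eqF//; case/andP: (s0 e ie).
(* The norm separates the two pieces of a new arc: it grows linearly from 0 to [r] along the radius
   and exceeds [r] afterwards. So outside the closed ball the old drawing is unchanged, and inside
   it only radii remain. *)
have nL e t : inc e -> 0 <= t -> t <= s e -> `|arc' e t| = t / s e * r.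
  move=> ie t0 ts; have /andP[se _] := s0 e ie.
  by rewrite arcL// normrZ pr// ger0_norm// divr_ge0// ltW.
have nLr e t : inc e -> 0 <= t -> t <= s e -> `|arc' e t| <= r.
  move=> ie t0 ts; have /andP[se _] := s0 e ie.
  by rewrite nL// ler_piMl// ?ler_pdivrMr ?mul1r// ltW.
have nR e t : inc e -> s e < t -> t <= 1 -> r < `|arc' e t|.
  move=> ie st t1; rewrite arcR ?ltW//.
  by have [_ _] := Hs e ie; apply; rewrite st.
have nN e t : e \in edges G -> ~~ inc e -> 0 <= t -> t <= 1 -> r < `|arc' e t|.
  move=> eG ie t0 t1; rewrite arcN//; apply: arc_far => //.
    by move: ie; rewrite /inc eG.
  by rewrite in_itv/= t0.
have out e t : e \in edges G -> 0 <= t -> t <= 1 -> r < `|arc' e t| ->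
    arc' e t = arc e t.
  move=> eG t0 t1; have [ie|ie] := boolP (inc e); last by rewrite arcN.
  have [ts|st] := leP t (s e); first by rewrite ltNge nLr.
  by rewrite arcR// ltW.
have inn e t : e \in edges G -> 0 <= t -> t <= 1 -> `|arc' e t| <= r ->
    inc e /\ t <= s e.
  move=> eG t0 t1 h; have [ie|ie] := boolP (inc e).
    by split=> //; rewrite leNgt; apply/negP => st; move: h; rewrite leNgt nR.
  by move: h; rewrite leNgt nN.
exists pos, arc', r, p; split => //.
- split => //.
  + move=> e eG; split; last first.
      have [_ ie] := parc e eG.
      move=> a b; rewrite !in_itv/= => /andP[a00 a1] /andP[b0 b1] ab.
      have [ar|ar] := leP `|arc' e a| r.
        have br := ar; rewrite ab in br.
        have [ince as_] := inn e a eG a00 a1 ar.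
        have [_ bs] := inn e b eG b0 b1 br.
        have := congr1 Num.norm ab; rewrite !nL// => /(mulIf (lt0r_neq0 r0)).
        by have /andP[/lt0r_neq0/invr_neq0 se _] := s0 e ince => /(mulIf se).
      have br := ar; rewrite ab in br.
      by apply: ie; rewrite ?in_itv/= ?a00 ?b0// -!out.
    apply: continuous_subspaceT => t; rewrite /arc'; case: (inc e); last exact: cD.
    apply: cvgD.
      apply: cvgB; last exact: cvg_cst.
      apply: (@continuous_comp _ _ _ (fun t => Num.max t (s e))); last exact: cD.
      by apply: continuous_max; [exact: cvg_id|exact: cvg_cst].
    apply: cvgZ; last exact: cvg_cst.
    apply: cvgM; last exact: cvg_cst.
    by apply: continuous_min; [exact: cvg_id|exact: cvg_cst].
  + move=> e eG; have [a [b [eE e0 e1]]] := pends e eG; exists a, b.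
    have [ie|ie] := boolP (inc e); last by rewrite arcN.
    have /andP[se0 se1] := s0 e ie; split=> //; last by rewrite arcR// ltW.
    rewrite arcL ?(ltW se0)// mul0r scale0r -e0 a0//; by case/andP: ie.
  + move=> e v t eG t01; move: (t01); rewrite in_itv/= => /andP[t0 t1].
    have [tr|tr] := leP `|arc' e t| r; last by rewrite out ?ltW//; exact: pav.
    have [ie ts] := inn e t eG (ltW t0) (ltW t1) tr.
    have [->|vx] := eqVneq v x; last first.
      by move=> etv; have := pos_far v vx; rewrite ltNge -etv tr.
    rewrite x0 => /(congr1 Num.norm)/eqP; rewrite normr0 nL ?(ltW t0)//.
    have /andP[se _] := s0 e ie.
    by rewrite !mulf_eq0 invr_eq0 !gt_eqF.
  + move=> e e' a b eG e'G ee' a01 b01 ab.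
    move: (a01) (b01); rewrite !in_itv/= => /andP[a00 a1] /andP[b0 b1].
    have [ar|ar] := leP `|arc' e a| r; last first.
      have br := ar; rewrite ab in br.
      by apply: (paa e e' a b) => //; rewrite -!out// ltW.
    have br := ar; rewrite ab in br.
    have [ie as_] := inn e a eG (ltW a00) (ltW a1) ar.
    have [ie' bs] := inn e' b e'G (ltW b0) (ltW b1) br.
    (* Two radii that meet do so at the same fraction of their length, so their exit points
       coincide; the original arcs would then cross at these points. *)
    have := congr1 Num.norm ab.
    rewrite !nL ?(ltW a00) ?(ltW b0)// => /(mulIf (lt0r_neq0 r0)) E.
    move: ab; rewrite !arcL// E.
    have h : b / s e' != 0.
      by have /andP[se _] := s0 e' ie'; rewrite mulf_neq0// ?invr_eq0 gt_eqF.
    move=> /(scalerI h); rewrite !pE//; apply: paa => //.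
      by have [] := Hs e ie.
    by have [] := Hs e' ie'.
- move=> z [[v <-]|[e [t [eG]]]].
    have [->|vx] := eqVneq v x; last by rewrite leNgt pos_far.
    (* The origin is the zero multiple of any vector, so any set of vertices serves as the index of
       the spoke. *)
    by exists [set x]%SET, 0; rewrite x0 scale0r lexx.
  rewrite in_itv/= => /andP[t0 t1] <- h.
  have [ie ts] := inn e t eG t0 t1 h; have /andP[se _] := s0 e ie.
  by exists e, (t / s e); rewrite arcL// divr_ge0// ltW.
Qed.

(** * A free ray issuing from a vertex *)

Lemma norm_pair_le (R : realType) (a b r : R) :
  (`|(a, b)| <= r) = (`|a| <= r) && (`|b| <= r).
Proof. by rewrite prod_normE/= comparable_ge_max// real_comparable. Qed.

Lemma norm_axis (R : realType) (a : R) : `|(a, 0 : R)| = `|a|.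
Proof.
by apply/le_anti; rewrite norm_pair_le normr0 lexx normr_ge0/= prod_normE/=
  comparable_le_max ?lexx// real_comparable.
Qed.

Section FreeRay.
Variables (R : realType) (V : finType) (G : sgraph V) (x : V).

Lemma free_segment_drawing : planar R G ->
  exists pos arc (eps : R), [/\ plane_drawing G pos arc, pos x = 0, 0 < eps &
    forall u, 0 < u <= eps -> ~ drawn G pos arc (u, 0)].
Proof.
move=> /(spoked_drawing x)[pos [arc [r [p [D x0 r0 Hp]]]]].
(* The direction [(1, s)] is steeper than every spoke; a shear makes it horizontal. *)
pose s := 1 + \sum_e `|(p e).2 / (p e).1|.
have s_gt e : (p e).2 / (p e).1 < s.
  rewrite /s (bigD1 e)//=; set q := (p e).2 / _.
  have := ler_norm q; have : 0 <= \sum_(i | i != e) `|(p i).2 / (p i).1|.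
    by apply: sumr_ge0.
  lra.
have s1 : 1 <= s by rewrite lerDl sumr_ge0.
pose phi (z : R * R) : R * R := (z.1, z.2 - s * z.1).
(* In the maximum norm the point (u, s u) has norm s u because s >= 1, so it stays in the ball of
   radius [r] as long as u <= r / s. *)
exists (phi \o pos), (fun e => phi \o arc e), (r / s).
have s0 : 0 < s by lra.
split.
- apply: drawing_map => // [[a b] [a' b'] _ _ [-> /addIr ->]//|[a b] _].
  apply: (@cvg_pair _ _ _ (nbhs (a, b)) (nbhs a) (nbhs (b - s * a))).
    exact: cvg_fst.
  apply: cvgB; first exact: cvg_snd.
  by apply: cvgM; [exact: cvg_cst|exact: cvg_fst].
- by rewrite /phi/= x0/= mulr0 subrr.
- by rewrite divr_gt0.
- move=> u /andP[u0 ur] /drawn_map[[a b] Dab [/= au bu]]; subst a.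
  have bE : b = s * u by lra.
  have [] := Hp _ Dab.
    rewrite norm_pair_le bE normrM (ger0_norm (ltW u0)) (ger0_norm (ltW s0)).
    move: ur; rewrite ler_pdivlMr// => ur.
    by apply/andP; split; nra.
  move=> e [v [v0]]; case: (p e) (s_gt e) => p1 p2 /= ps [u1 b2].
  have {}u1 : u = v * p1 := u1; have {}b2 : b = v * p2 := b2.
  (* A vertical spoke, whose slope takes the default value 0, is excluded here because u > 0. *)
  have : v * p1 != 0 by rewrite -u1 gt_eqF.
  rewrite mulf_eq0 negb_or => /andP[vn pn].
  suff ss : p2 / p1 = s by rewrite ss ltxx in ps.
  apply: (mulIf pn); apply: (mulfI vn); rewrite divfK//.
  by rewrite -b2 bE u1; ring.
Qed.

(* Inversion about a point [c] of the free segment turns the part of the segment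
   between [x] and [c] into a free ray, and bounds the drawing because a
   neighbourhood of [c] is free. *)
Lemma free_ray_drawing : planar R G ->
  exists pos arc (M : R), [/\ plane_drawing G pos arc, pos x = 0,
    forall z, drawn G pos arc z -> `|z| <= M &
    forall u, 0 < u -> ~ drawn G pos arc (u, 0)].
Proof.
move=> /free_segment_drawing[pos [arc [eps [D x0 eps0 Hs]]]].
pose c : R * R := (eps, 0).
have cD : ~ drawn G pos arc c by apply: Hs; rewrite eps0 lexx.
have [rho /= rho0 Hrho] := proj1 (nbhs_normP _ _) (drawn_avoid_near D cD).
(* The inversion uses the maximum norm: it keeps directions from [c] and replaces the distance to
   [c] by its reciprocal, which suffices for injectivity and boundedness. *)
pose psi (z : R * R) : R * R := (`|z - c| ^- 2) *: (z - c).
have zc z : drawn G pos arc z -> z - c != 0.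
  by move=> zD; rewrite subr_eq0; apply: contra_not_neq cD => <-.
have npsi z : `|psi z| = `|z - c|^-1.
  have [h|h] := eqVneq (z - c) 0.
    by rewrite /psi h scaler0 normr0 invr0.
  rewrite normrZ ger0_norm ?invr_ge0 ?exprn_ge0//.
  by rewrite expr2 invfM mulfVK// normr_eq0.
have psiI z w : z - c != 0 -> w - c != 0 -> psi z = psi w -> z = w.
  move=> hz hw E; have := congr1 Num.norm E; rewrite !npsi => /invr_inj nE.
  move: E; rewrite /psi nE => /scalerI.
  by rewrite invr_eq0 expf_eq0/= normr_eq0 => /(_ hw)/addIr.
(* The sign and the shift put [x] back at the origin and make the ray point right: (u, 0) goes to
   (1/(eps - u) - 1/eps, 0). *)
pose phi z := psi 0 - psi z.
have psi_axis u : u < eps -> psi (u, 0) = (- (eps - u)^-1, 0).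
  move=> ue; rewrite /psi /c; have -> : (u, 0) - (eps, 0) = (u - eps, 0) :> R * R.
    by congr pair; rewrite /= subr0.
  rewrite norm_axis distrC ger0_norm ?subr_ge0 ?ltW//.
  have h : eps - u != 0 by rewrite subr_eq0 gt_eqF.
  by congr pair; rewrite /= ?mulr0// /GRing.scale/=; field.
exists (phi \o pos), (fun e => phi \o arc e), (`|psi 0| + rho^-1); split.
- apply: drawing_map => // [z w /zc hz /zc hw /addrI/oppr_inj|z /zc hz].
    exact: psiI.
  apply: cvgB; first exact: cvg_cst.
  have cB : (fun w => w - c) @ z --> z - c by apply: cvgB; [exact: cvg_id|exact: cvg_cst].
  apply: cvgZ => //; apply: cvgV; first by rewrite expf_eq0 normr_eq0.
  by apply: (@cvgM _ _ _ _ (fun w => `|w - c|) (fun w => `|w - c|));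
    exact: cvg_norm.
- by rewrite /phi/= x0 subrr.
- move=> _ /drawn_map[z zD <-]; rewrite (le_trans (ler_normB _ _))// lerD2l npsi.
  have h : 0 < `|z - c| by rewrite normr_gt0 zc.
  rewrite lef_pV2 ?posrE// leNgt; apply/negP => zr; apply: (Hrho z) => //=.
  by rewrite distrC.
- move=> y y0 /drawn_map[z zD].
  have h0 : 0 < y + eps^-1 by rewrite addr_gt0// invr_gt0.
  (* This solves 1/(eps - u) - 1/eps = y. *)
  pose u := eps - (y + eps^-1)^-1.
  have u0 : 0 < u.
    rewrite subr_gt0 -[ltRHS]invrK ltf_pV2 ?posrE ?invr_gt0//; lra.
  have ue : u < eps by rewrite /u ltrBlDr ltrDl invr_gt0.
  have <- : phi (u, 0) = (y, 0).
    rewrite /phi (psi_axis u ue) (psi_axis 0 eps0) subr0.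
    have -> : eps - u = (y + eps^-1)^-1 by rewrite /u; ring.
    by rewrite invrK; congr pair; rewrite /= ?subrr//; ring.
  move=> /addrI/oppr_inj/psiI => /(_ (zc _ zD)) E.
  apply: (Hs u); first by rewrite u0 ltW.
  rewrite -E// subr_eq0; apply/eqP => -[uE]; by rewrite uE ltxx in ue.
Qed.
End FreeRay.

(** * Adding a bridge to a planar graph *)

Lemma adj_sym (V : finType) (G : sgraph V) : symmetric (adj G).
Proof. by move=> a b; rewrite /adj finset.setUC. Qed.

(* The component of [x] is drawn with a free ray from [x] pointing right, the rest, far
   to the right of it, with a free ray from [y] pointing left. *)
Lemma planar_add_bridge (R : realType) (V : finType) (G G' : sgraph V) (x y : V) :
  planar R G -> ~~ connect (adj G) x y ->
  edges G' = ([set x; y] |: edges G)%SET -> planar R G'.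
Proof.
move=> Gp xy G'E.
have [pos1 [arc1 [M1 [D1 x1 b1 f1]]]] := free_ray_drawing x Gp.
have [pos0 [arc0 [M2 [D0 y0 b0 f0]]]] := free_ray_drawing y Gp.
(* The first drawing has abscissas at most M1. The second, reflected and shifted by [K], has
   abscissas at least K - M2 = M1 + 1, so the two are disjoint. *)
pose K := M1 + M2 + 1.
have M10 : 0 <= M1.
  by apply: le_trans (b1 _ (drawn_vertex _ _ _ x)); exact: normr_ge0.
have M20 : 0 <= M2.
  by apply: le_trans (b0 _ (drawn_vertex _ _ _ x)); exact: normr_ge0.
have K0 : 0 < K by rewrite /K; lra.
pose phi (z : R * R) : R * R := (K - z.1, z.2).
pose pos2 := phi \o pos0; pose arc2 e := phi \o arc0 e.
have D2 : plane_drawing G pos2 arc2.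
  apply: drawing_map => // [[a b] [a' b'] _ _ [/addrI/oppr_inj -> ->]//|[a b] _].
  apply: (@cvg_pair _ _ _ (nbhs (a, b)) (nbhs (K - a)) (nbhs b)).
    by apply: cvgB; [exact: cvg_cst|exact: cvg_fst].
  exact: cvg_snd.
have y2 : pos2 y = (K, 0) by rewrite /pos2/= y0 /phi/= subr0.
have h1 z : drawn G pos1 arc1 z -> z.1 <= M1.
  move: z => [a b] /b1; rewrite norm_pair_le => /andP[+ _].
  by apply: le_trans; exact: ler_norm.
have h2 z : drawn G pos2 arc2 z -> M1 < z.1.
  move=> /drawn_map[[a b] /b0 + <-]; rewrite norm_pair_le => /andP[+ _] /=.
  by move=> /(le_trans (ler_norm a)); rewrite /K; lra.
have f2 u : u < K -> ~ drawn G pos2 arc2 (u, 0).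
  move=> uK /drawn_map[[a b] Dab [/= aE bE]]; subst b.
  have a0 : 0 < a by lra.
  exact: f0 a0 Dab.
have sep z w : drawn G pos1 arc1 z -> drawn G pos2 arc2 w -> z <> w.
  by move=> /h1 hz /h2 hw zw; rewrite zw leNgt hw in hz.
pose S v := connect (adj G) x v.
have Sx : S x by exact: connect0.
have Sy : S y = false by apply/negbTE.
have Sedge a b : [set a; b]%SET \in edges G -> S a = S b.
  move=> ab; apply: same_connect_r; last exact: connect1.
  exact/sym_connect_sym/adj_sym.
pose e0 := [set x; y]%SET.
have e0G : e0 \notin edges G.
  by apply: contra xy => ?; exact: connect1.
pose Se (e : {set V}) := [exists v in e, S v].
have SeE a b : [set a; b]%SET \in edges G -> Se [set a; b]%SET = S a.
  move=> ab; apply/existsP/idP => [[v /andP[]]|Sa].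
    by rewrite !inE => /orP[]/eqP -> //; rewrite (Sedge _ _ ab).
  by exists a; rewrite !inE eqxx.
(* Both drawings show all of [G]; the component of [x] is taken from the first and everything else
   from the second. The bridge is the segment from (0, 0) to (K, 0), whose interior lies on both
   free rays. *)
pose pos v := if S v then pos1 v else pos2 v.
pose arc (e : {set V}) t := if e == e0 then (t * K, 0) else
  if Se e then arc1 e t else arc2 e t.
have arcE e : e \in edges G -> arc e = if Se e then arc1 e else arc2 e.
  move=> eG; apply/funext => t; rewrite /arc ifN ?[in RHS]fun_if; first by case: ifP.
  by apply: contraNneq e0G => <-.
have arc00 : arc e0 = fun t => (t * K, 0) by apply/funext => t; rewrite /arc eqxx.
have seg_avoid t z : 0 < t < 1 -> (drawn G pos1 arc1 z \/ drawn G pos2 arc2 z) ->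
    (t * K, 0) <> z.
  move=> /andP[t0 t1] [zD|zD] zE; move: zD; rewrite -zE.
    by apply: f1; rewrite mulr_gt0.
  by apply: f2; rewrite gtr_pMl.
exists pos, arc; split.
- move=> v w; rewrite /pos; case: ifP => _; case: ifP => _.
  + exact: drawing_pos_inj D1 v w.
  + by move=> /sep; case; [left; exists v|left; exists w].
  + by move=> /esym/sep; case; [left; exists w|left; exists v].
  + exact: drawing_pos_inj D2 v w.
- move=> e; rewrite G'E in_setU1 => /orP[/eqP->|eG]; last first.
    by rewrite arcE//; case: ifP => _; [exact: (drawing_arc D1)|exact: (drawing_arc D2)].
  rewrite [X in simple_arc X]arc00; split.
    apply: continuous_subspaceT => t.
    apply: (@cvg_pair _ _ _ (nbhs t) (nbhs (t * K)) (nbhs (0 : R))); last exact: cvg_cst.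
    by apply: cvgM; [exact: cvg_id|exact: cvg_cst].
  by move=> s t _ _ [/mulIf]; apply; rewrite gt_eqF.
- move=> e; rewrite G'E in_setU1 => /orP[/eqP->|eG].
    exists x, y; rewrite arc00 /pos Sx Sy x1 y2 mul0r mul1r; split => //.
  rewrite arcE//; case: ifPn => Ee.
    have [a [b [eE ea eb]]] := drawing_ends D1 eG; exists a, b.
    rewrite eE in eG Ee; rewrite SeE// in Ee.
    by rewrite /pos -(Sedge _ _ eG) Ee.
  have [a [b [eE ea eb]]] := drawing_ends D2 eG; exists a, b.
  rewrite eE in eG Ee; rewrite SeE// in Ee.
  by rewrite /pos -(Sedge _ _ eG) (negbTE Ee).
- move=> e v t; rewrite G'E in_setU1 => /orP[/eqP->|eG] t01.
    rewrite arc00; apply: seg_avoid; first by rewrite in_itv in t01.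
    by rewrite /pos; case: ifP => _; [left|right]; left; exists v.
  have t01' := itvoo01_cc t01.
  rewrite arcE// /pos; case: ifP => _; case: ifP => _.
  + exact: (drawing_arc_vertex D1).
  + by apply: sep; [exact: drawn_arc|exact: drawn_vertex].
  + by apply/nesym/sep; [exact: drawn_vertex|exact: drawn_arc].
  + exact: (drawing_arc_vertex D2).
- have seg_arc e s t : e \in edges G -> s \in `]0, 1[ -> t \in `]0, 1[ ->
      arc e0 s <> arc e t.
    move=> eG s01 /itvoo01_cc t01; rewrite arc00.
    apply: seg_avoid; first by rewrite in_itv in s01.
    by rewrite arcE//; case: ifP => _; [left|right]; exact: drawn_arc.
  move=> e e' s t; rewrite !G'E !in_setU1.
  move=> /orP[/eqP->|eG] /orP[/eqP->|e'G] ee' s01 t01 //.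
  + exact: seg_arc.
  + exact/nesym/seg_arc.
  have s01' := itvoo01_cc s01; have t01' := itvoo01_cc t01.
  rewrite !arcE//; case: ifP => _; case: ifP => _.
  + exact: (drawing_arc_arc D1).
  + by apply: sep; exact: drawn_arc.
  + by apply/nesym/sep; exact: drawn_arc.
  + exact: (drawing_arc_arc D2).
Qed.

(** * Counting *)

(** Discarding the sets that are not pairs makes the construction total on families of vertex sets,
    so no proof of simplicity has to be carried along. *)
Fact simple_part_subproof (V : finType) (E : {set {set V}}) :
  {G : sgraph V | edges G = [set e in E | #|e| == 2%N]%SET}.
Proof.
have E2 : [forall e in [set e in E | #|e| == 2%N]%SET, #|e| == 2%N].
  by apply/forall_inP => e; rewrite inE => /andP[].
by exists (SGraph E2).
Qed.

Definition simple_part (V : finType) (E : {set {set V}}) : sgraph V :=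
  sval (simple_part_subproof E).

Lemma edges_simple_part (V : finType) (E : {set {set V}}) :
  (forall e, e \in E -> #|e| = 2%N) -> edges (simple_part E) = E.
Proof.
move=> E2; rewrite (svalP (simple_part_subproof E)).
by apply/setP => e; rewrite inE andb_idr// => /E2 ->.
Qed.

Lemma edges_inj (V : finType) : injective (@edges V).
Proof. exact: val_inj. Qed.

Lemma planar_sub (R : realType) (V : finType) (G G' : sgraph V) :
  edges G' \subset edges G -> planar R G -> planar R G'.
Proof.
move=> /fintype.subsetP sGG [pos [arc [pinj parc pends pav paa]]]; exists pos, arc.
split=> // [e /sGG|e /sGG|e v t /sGG|e e' s t /sGG eG /sGG].
- exact: parc.
- exact: pends.
- exact: pav.
- exact: paa.
Qed.

Lemma card_component (V : finType) (G : sgraph V) (v : V) :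
  (#|connect (adj G) v| <= #|edges G|.+1)%N.
Proof.
(* A maximal [S] spanning at least [#|S| - 1] edges is closed under adjacency. *)
pose P (S : {set V}) :=
  (v \in S) && (#|S| <= #|[set e in edges G | e \subset S]|.+1)%N.
have P0 : P [set v]%SET by rewrite /P inE eqxx cards1.
have [S /andP[vS cS] Smax] := @arg_maxnP _ [set v]%SET P (fun S => #|S|) P0.
have Scl : fingraph.closed (adj G) (mem S).
  apply: intro_closed; first exact/sym_connect_sym/adj_sym.
  (* Adding a neighbour [b] outside [S] gains one vertex and at least the edge from [a] to [b],
     against maximality. *)
  move=> a b ab aS; apply: contraT => bS.
  suff /Smax : P (b |: S)%SET by rewrite /geq/= cardsU1 bS add1n ltnn.
  rewrite /P !inE vS orbT/= cardsU1 bS add1n ltnS (leq_trans cS)//.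
  apply: proper_card; apply/properP; split.
    apply/fintype.subsetP => e; rewrite !inE => /andP[-> /fintype.subset_trans]; apply.
    exact: finset.subsetUr.
  have abG : [set a; b]%SET \in edges G := ab.
  exists [set a; b]%SET; first by rewrite inE abG finset.subUset !finset.sub1set !inE aS eqxx orbT.
  by rewrite inE negb_and finset.subUset !finset.sub1set (negbTE bS) andbF orbT.
apply: leq_trans (_ : #|S| <= _)%N.
  apply/subset_leq_card/fintype.subsetP => w; rewrite inE => vw.
  by have <- : (v \in S) = (w \in S) := closed_connect Scl vw.
apply: leq_trans cS _; rewrite ltnS; apply/subset_leq_card/fintype.subsetP => e.
by rewrite inE => /andP[].
Qed.

(** An ordered pair of adjacent vertices is determined by its edge and its first entry, and an edge
    offers two choices of the latter. *)
Lemma card_endpoint_pairs (V : finType) (G : sgraph V) :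
  (#|[set p : V * V | [set p.1; p.2]%SET \in edges G]%SET| <= 2 * #|edges G|)%N.
Proof.
pose g (p : V * V) := ([set p.1; p.2]%SET, p.1).
have g_inj : {in [set p : V * V | [set p.1; p.2]%SET \in edges G]%SET &, injective g}.
  move=> [a b] [a' b']; rewrite !inE /g/= => /edge_card2; rewrite cards2.
  have [<-//|ab _] := eqVneq a b.
  move=> /edge_card2; rewrite cards2; have [<-//|ab' _] := eqVneq a' b'.
  case=> E aa; subst a'; congr pair.
  have : b \in [set a; b']%SET by rewrite -E !inE eqxx orbT.
  by rewrite !inE eq_sym (negbTE ab) => /eqP.
rewrite -(card_in_imset g_inj).
apply: (@leq_trans #|[set q : {set V} * V | (q.1 \in edges G) && (q.2 \in q.1)]%SET|).
  apply/subset_leq_card/fintype.subsetP => _ /imsetP[[a b] + ->].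
  by rewrite !inE/= eqxx => ->.
rewrite -sum1_card (eq_bigl (fun q => (q.1 \in edges G) && (q.2 \in q.1)))//; last first.
  by move=> q; rewrite inE.
rewrite -(pair_big_dep (mem (edges G)) (fun e w => w \in e) (fun _ _ => 1%N))/=.
rewrite (eq_bigr (fun=> 2%N)).
  by rewrite sum_nat_const mulnC.
by move=> e eG; rewrite sum1_card (edge_card2 eG).
Qed.

Section Counting.
Variables (R : realType) (n : nat).

Lemma planar_graphs_step (j : nat) :
  (#|planar_graphs R n j| * (n * (n - j.+1)) <=
   #|planar_graphs R n j.+1| * (2 * j.+1))%N.
Proof.
(* Double counting of the pairs (graph, oriented bridge that can be added to it). *)
pose A := [set t : sgraph 'I_n * ('I_n * 'I_n) | (t.1 \in planar_graphs R n j) &&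
  ~~ connect (adj t.1) t.2.1 t.2.2]%SET.
pose B := [set t : sgraph 'I_n * ('I_n * 'I_n) | (t.1 \in planar_graphs R n j.+1) &&
  ([set t.2.1; t.2.2]%SET \in edges t.1)]%SET.
pose f (t : sgraph 'I_n * ('I_n * 'I_n)) :=
  (simple_part ([set t.2.1; t.2.2] |: edges t.1)%SET, t.2).
have addE (G : sgraph 'I_n) x y : ~~ connect (adj G) x y ->
    edges (simple_part ([set x; y] |: edges G)%SET) = ([set x; y] |: edges G)%SET.
  move=> xy; apply: edges_simple_part => e; rewrite !inE => /orP[/eqP->|/edge_card2//].
  rewrite cards2; case: eqVneq => // xyE; by rewrite xyE connect0 in xy.
have fresh (G : sgraph 'I_n) x y : ~~ connect (adj G) x y -> [set x; y]%SET \notin edges G.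
  by apply: contra => ?; exact: connect1.
have leAB : (#|A| <= #|B|)%N.
  (* The added edge is new and the pair is remembered, so removing the edge recovers the graph. *)
  have finj : {in A &, injective f}.
    move=> [G [x y]] [G' [x' y']]; rewrite !inE/= => /andP[_ xy] /andP[_ xy'] [E xx yy].
    subst x' y'; congr pair; apply: edges_inj.
    have := congr1 (@edges _) E; rewrite !addE// => E'.
    by rewrite -(finset.setU1K (fresh _ _ _ xy)) E' finset.setU1K// fresh.
  rewrite -(card_in_imset finj); apply/subset_leq_card/fintype.subsetP.
  move=> _ /imsetP[[G [x y]] GA ->]; move: GA.
  rewrite inE => /andP[/= + xy]; rewrite inE => /andP[/asboolP Gp /eqP Gj].
  rewrite inE /f/= addE// setU11 andbT inE addE// cardsU1 fresh// Gj eqxx andbT.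
  by apply/asboolP; exact: (planar_add_bridge Gp xy (addE _ _ _ xy)).
have cardA : #|A| = (\sum_(G in planar_graphs R n j)
    #|[set p : 'I_n * 'I_n | ~~ connect (adj G) p.1 p.2]%SET|)%N.
  rewrite -sum1_card (eq_bigl (fun t => (t.1 \in planar_graphs R n j) &&
    ~~ connect (adj t.1) t.2.1 t.2.2)); last by move=> t; rewrite inE.
  rewrite -(pair_big_dep (mem (planar_graphs R n j))
    (fun G p => ~~ connect (adj G) p.1 p.2) (fun _ _ => 1%N))/=.
  by apply: eq_bigr => G _; rewrite -sum1_card; apply: eq_bigl => p; rewrite inE.
have cardB : #|B| = (\sum_(G in planar_graphs R n j.+1)
    #|[set p : 'I_n * 'I_n | [set p.1; p.2]%SET \in edges G]%SET|)%N.
  rewrite -sum1_card (eq_bigl (fun t => (t.1 \in planar_graphs R n j.+1) &&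
    ([set t.2.1; t.2.2]%SET \in edges t.1))); last by move=> t; rewrite inE.
  rewrite -(pair_big_dep (mem (planar_graphs R n j.+1))
    (fun G p => [set p.1; p.2]%SET \in edges G) (fun _ _ => 1%N))/=.
  by apply: eq_bigr => G _; rewrite -sum1_card; apply: eq_bigl => p; rewrite inE.
apply: leq_trans (leq_trans leAB _).
  (* Each vertex lies in a component of at most j + 1 vertices, so at least n - (j + 1) vertices are
     outside it. *)
  rewrite cardA -sum_nat_const; apply: leq_sum => G; rewrite inE => /andP[_ /eqP Gj].
  rewrite -sum1_card (eq_bigl (fun p => true && ~~ connect (adj G) p.1 p.2)); last first.
    by move=> p; rewrite inE.
  rewrite -(pair_big_dep predT (fun v w => ~~ connect (adj G) v w) (fun _ _ => 1%N))/=.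
  rewrite -{1}(card_ord n) -sum_nat_const; apply: leq_sum => v _; rewrite sum1_card.
  have := cardC (connect (adj G) v); rewrite card_ord => cC.
  have := card_component G v; rewrite Gj => le_j.
  by rewrite leq_subLR -[leqLHS]cC leq_add.
rewrite cardB -sum_nat_const; apply: leq_sum => G; rewrite inE => /andP[_ /eqP <-].
exact: card_endpoint_pairs.
Qed.

(** Each of the [i] steps reaches an edge count l <= m < n, so n - l >= n - m and 2 l <= 2 n;
    cancelling n leaves a factor (n - m) / 2 per step. *)
Lemma planar_graphs_growth (m i j : nat) : (m < n)%N -> (j + i <= m)%N ->
  (#|planar_graphs R n j| * (n - m) ^ i <= 2 ^ i * #|planar_graphs R n (j + i)|)%N.
Proof.
move=> mn; elim: i => [|i IH] jm; first by rewrite addn0 muln1 mul1n.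
have n0 : (0 < n)%N by lia.
have step : (#|planar_graphs R n (j + i)| * (n - m) <=
    2 * #|planar_graphs R n (j + i).+1|)%N.
  have := planar_graphs_step (j + i); set a := #|_|; set b := #|_| => h.
  have : (a * (n * (n - m)) <= b * (2 * n))%N.
    by apply: leq_trans (leq_trans h _); rewrite !leq_mul//; lia.
  by move=> h'; rewrite -(leq_pmul2l n0); lia.
rewrite expnSr mulnA; apply: leq_trans (leq_mul (IH _) (leqnn _)) _; first by lia.
by rewrite -mulnA expnSr -mulnA leq_mul2l addnS step orbT.
Qed.

(** Sending (G, f) to (G minus the copy of [H] placed by f, f) is injective, since f tells which
    edges to put back. The placements are bounded by all maps from [T] to the n labels. *)
Lemma card_with_subgraph (T : finType) (H : sgraph T) (m : nat) :
  (#|[set G in planar_graphs R n m | `[< has_subgraph H G >]]%SET| <=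
   #|planar_graphs R n (m - #|edges H|)| * n ^ #|T|)%N.
Proof.
pose copy (f : {ffun T -> 'I_n}) := ((fun e : {set T} => f @: e) @: edges H)%SET.
pose S := [set t : sgraph 'I_n * {ffun T -> 'I_n} | [&& t.1 \in planar_graphs R n m,
  injectiveb t.2 & copy t.2 \subset edges t.1]]%SET.
have copy_card (f : {ffun T -> 'I_n}) : injective f -> #|copy f| = #|edges H|.
  by move=> finj; apply/card_imset/imset_inj.
have le1 : (#|[set G in planar_graphs R n m | `[< has_subgraph H G >]]%SET| <= #|S|)%N.
  apply: leq_trans (leq_imset_card fst S).
  apply/subset_leq_card/fintype.subsetP => G; rewrite inE => /andP[Gp /asboolP[f finj fH]].
  apply/imsetP; exists (G, [ffun x => f x]) => //; rewrite inE Gp/=; apply/andP; split.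
    by apply/injectiveP => a b; rewrite !ffunE => /finj.
  apply/fintype.subsetP => _ /imsetP[e eH ->]; have := fH e eH.
  by rewrite (eq_imset e (g := f)) => // a; rewrite ffunE.
apply: leq_trans le1 _.
have minusE (G : sgraph 'I_n) E :
    edges (simple_part (edges G :\: E)%SET) = (edges G :\: E)%SET.
  by apply: edges_simple_part => e; rewrite inE => /andP[_ /edge_card2].
pose g (t : sgraph 'I_n * {ffun T -> 'I_n}) :=
  (simple_part (edges t.1 :\: copy t.2)%SET, t.2).
have ginj : {in S &, injective g}.
  move=> [G f] [G' f']; rewrite !inE/= => /and3P[_ _ sG] /and3P[_ _ sG'] [E ff].
  subst f'; congr pair; apply: edges_inj.
  have := congr1 (@edges _) E; rewrite !minusE => E'.
  by rewrite -(finset.setID (edges G) (copy f)) -(finset.setID (edges G') (copy f)) E'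
    (finset.setIidPr sG) (finset.setIidPr sG').
rewrite -(card_in_imset ginj) -[X in (X ^ _)%N]card_ord -card_ffun -cardsT -cardsX.
apply/subset_leq_card/fintype.subsetP => _ /imsetP[[G f] GS ->]; move: GS.
rewrite inE => /and3P[/= + /injectiveP finj sG]; rewrite inE.
move=> /andP[/asboolP Gp /eqP Gm].
rewrite inE /g/= finset.in_setT andbT inE minusE; apply/andP; split.
  by apply/asboolP; apply: planar_sub Gp; rewrite minusE finset.subsetDl.
by rewrite cardsD (finset.setIidPr sG) Gm copy_card.
Qed.
End Counting.

(** * The probability bound and its limit *)

Lemma card_with_subgraph_bound (R : realType) (T : finType) (H : sgraph T) (n m : nat) :
  (m < n)%N ->
  (#|[set G in planar_graphs R n m | `[< has_subgraph H G >]]%SET| *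
     (n - m) ^ #|edges H| <=
   2 ^ #|edges H| * n ^ #|T| * #|planar_graphs R n m|)%N.
Proof.
(* If m < e(H), no graph contains [H]; this case is split off because the truncated m - e(H) would
   break the identity m - e(H) + e(H) = m. *)
move=> mn; have [km|mk] := leqP #|edges H| m; last first.
  rewrite (_ : #|_| = 0%N)// ?mul0n//; apply: eq_card0 => G; apply/negP.
  rewrite !inE => /andP[/andP[_ /eqP Gm] /asboolP[f finj fH]].
  move: mk; rewrite -Gm ltnNge -(card_imset (mem (edges H)) (imset_inj finj)).
  by move/negP; apply; apply/subset_leq_card/fintype.subsetP => _ /imsetP[e /fH eG ->].
apply: leq_trans (leq_mul (card_with_subgraph R n H m) (leqnn _)) _.
rewrite mulnAC [leqRHS]mulnAC leq_mul2r; apply/orP; right.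
have := @planar_graphs_growth R n m #|edges H| (m - #|edges H|) mn.
by rewrite subnK// => /(_ (leqnn _)).
Qed.

Theorem theorem11p1 (R : realType) (T : finType) (H : sgraph T)
  (H_connected : connected_graph H) (H_planar : planar R H)
  (H_edges : (#|T| < #|edges H|)%N)
  (m : nat -> nat) (d : nat -> R)
  (d_def : forall n : nat, d n = n%:R - (m n)%:R)
  (d_gt0 : \forall n \near \oo, 0 < d n)
  (d_omega : d n / (n%:R `^ (#|T|%:R / #|edges H|%:R)) @[n --> \oo] --> +oo) :
  prob_planar R (m n) (fun G : sgraph 'I_n => has_subgraph H G) @[n --> \oo]
    --> (0 : R).
Proof.
set k := #|edges H| in H_edges d_omega *; set h := #|T| in H_edges d_omega *.
have k0 : (0 < k)%N by lia.
set q := fun n => d n / _ in d_omega.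
have qV : (q n)^-1 @[n --> \oo] --> (0 : R).
  apply/gtr0_cvgV0 => //; near=> n.
  have dn0 : 0 < d n by near: n.
  have n0 : (0 < n)%N by near: n; exact: nbhs_infty_gt.
  by rewrite divr_gt0// powR_gt0// ltr0n.
have q2 : 2 * (q n)^-1 @[n --> \oo] --> (2 * 0 : R) by apply: cvgM => //; exact: cvg_cst.
have lim : (2 * (q n)^-1) ^+ k @[n --> \oo] --> (0 : R).
  (* The power of the limit vanishes because the exponent [k] is positive. *)
  have := continuous_cvg _ (@exprn_continuous R k (2 * 0)) q2.
  by rewrite mulr0 expr0n gtn_eqF//; apply.
apply: (squeeze_cvgr _ (cvg_cst (0 : R)) lim).
near=> n.
have dn0 : 0 < d n by near: n.
have mn : (m n < n)%N by move: dn0; rewrite d_def subr_gt0 ltr_nat.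
have n0 : 0 < n%:R :> R by rewrite ltr0n; lia.
have dE : d n = (n - m n)%:R by rewrite d_def natrB// ltnW.
apply/andP; split; first by rewrite /prob_planar divr_ge0.
rewrite /prob_planar; set B := #|_|; set N := #|_|.
(* With no graph in the class the probability takes its default value 0. *)
have [N0|N0] := posnP N.
  by rewrite N0 invr0 mulr0 exprn_ge0// mulr_ge0// invr_ge0 divr_ge0// ?powR_ge0// ltW.
have key : B%:R * d n ^+ k <= 2 ^+ k * n%:R ^+ h * N%:R.
  rewrite dE -!natrX -!natrM ler_nat; exact: card_with_subgraph_bound.
(* The k-th power of n^(h/k) is n^h, so the counting bound is exactly the vanishing sequence. *)
have -> : (2 * (q n)^-1) ^+ k = 2 ^+ k * n%:R ^+ h / d n ^+ k.
  rewrite /q invf_div !exprMn exprVn mulrA; congr (_ * _ / _).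
  rewrite -powR_mulrn ?powR_ge0// -powRrM divfK ?powR_mulrn ?ltW//.
  by rewrite pnatr_eq0 -lt0n.
rewrite ler_pdivrMr ?ltr0n// mulrAC ler_pdivlMr ?exprn_gt0//.
Unshelve. all: by end_near. Qed.
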